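(* Let $P\subseteq\mathbb{R}$ with the usual total order and let $K$ be a field. Let $f:M\to N$ be a monomorphism between persistence modules $M,N:P\to\mathbf{Vect}_K$ with direct-sum decompositions into finitely many interval modules. Then there are internal direct sum decompositions $M=\bigoplus_{a\in A}M_a$ and $N=\bigoplus_{a\in A}N_a$, where each $M_a$ is either an interval module or zero and each $N_a$ is an interval module, such that the following hold. Let $i_a:M_a\to M$ and $p'_a:N\to N_a$ denote the canonical maps. For all $a\in A$, if $M_a$ is nonzero then: - $M_a$ and $N_a$ have the same right end; - $p'_afi_a:M_a\to N_a$ is a monomorphism; - for all other interval modules $N_b$ ($b\ne a$) with the same right end as $M_a$, $p'_bfi_a=0$; - for all other interval modules $M_b$ ($b\neq a$) with the same right end as $N_a$, $p'_afi_b=0$.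
   Context: $P$ is viewed as a category via $\le$; a persistence module is a functor $P\to\mathbf{Vect}_K$, and morphisms are natural transformations. An interval in $P$ is a nonempty convex subset. The interval module of an interval $I$ has value $K$ at points of $I$, $0$ elsewhere, and identity maps between points of $I$; a summand isomorphic to such a module is also called an interval module, and is referred to by its interval. Two intervals $I$ and $J$ (or the corresponding interval modules) have the same right end if $\sup I=\sup J$ and ($\sup I\in I$ if and only if $\sup J\in J$). *)

(* Defs.v *)
From HB Require Import structures.
From mathcomp Require Import all_boot all_order all_algebra.
From mathcomp Require Import boolp classical_sets reals constructive_ereal ereal.
Set Implicit Arguments.
Unset Strict Implicit.
Unset Printing Implicit Defensive.
Import Order.TTheory GRing.Theory Num.Theory.
Local Open Scope classical_set_scope.
Local Open Scope ring_scope.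

(* The points of the poset are the elements [x : P] of the subtype of [R]
   attached to [P : set R], ordered by [val x <= val y]. This is a boolean, so
   there is at most one arrow between two points. *)
Record persmod (R : realType) (P : set R) (K : fieldType) := PersMod {
  pobj :> P -> lmodType K;
  ptr : forall x y : P, val x <= val y -> {linear pobj x -> pobj y};
  ptr_id : forall (x : P) (h : val x <= val x) (v : pobj x), ptr h v = v;
  ptr_comp : forall (x y z : P) (hxy : val x <= val y) (hyz : val y <= val z)
    (hxz : val x <= val z) (v : pobj x), ptr hyz (ptr hxy v) = ptr hxz v
}.

Record pmor (R : realType) (P : set R) (K : fieldType) (M N : persmod P K) :=
  PMor {
  hmap :> forall x : P, {linear M x -> N x};
  hmap_nat : forall (x y : P) (h : val x <= val y) (v : M x),
    hmap y (ptr M h v) = ptr N h (hmap x v)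
}.

Definition hom_eq (R : realType) (P : set R) (K : fieldType)
  (M N : persmod P K) (f g : pmor M N) : Prop :=
  forall (x : P) (v : M x), f x v = g x v.

Section Category.
Context (R : realType) (P : set R) (K : fieldType).
Implicit Types L M N : persmod P K.

Lemma id_hom_nat M (x y : P) (h : val x <= val y) (v : M x) :
  [the {linear M y -> M y} of idfun] (ptr M h v)
  = ptr M h ([the {linear M x -> M x} of idfun] v).
Proof. by []. Qed.

Definition id_hom M : pmor M M := PMor (@id_hom_nat M).

Lemma comp_hom_nat L M N (g : pmor M N) (f : pmor L M)
    (x y : P) (h : val x <= val y) (v : L x) :
  [the {linear L y -> N y} of g y \o f y] (ptr L h v)
  = ptr N h ([the {linear L x -> N x} of g x \o f x] v).
Proof. by rewrite /= !hmap_nat. Qed.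

Definition comp_hom L M N (g : pmor M N) (f : pmor L M) : pmor L N :=
  PMor (comp_hom_nat g f).

Lemma zero_hom_nat M N (x y : P) (h : val x <= val y) (v : M x) :
  [the {linear M y -> N y} of \0] (ptr M h v)
  = ptr N h ([the {linear M x -> N x} of \0] v).
Proof. by rewrite /= linear0. Qed.

Definition zero_hom M N : pmor M N := PMor (@zero_hom_nat M N).

Definition mono M N (f : pmor M N) : Prop :=
  forall L (g h : pmor L M),
    hom_eq (comp_hom f g) (comp_hom f h) -> hom_eq g h.

Definition isomorphic M N : Prop :=
  exists (f : pmor M N) (g : pmor N M),
    hom_eq (comp_hom g f) (id_hom M) /\ hom_eq (comp_hom f g) (id_hom N).

Definition zero_module M : Prop := forall (x : P) (v : M x), v = 0.

End Category.

Record pinterval (R : realType) (P : set R) := PInterval {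
  iset :> set P;
  iset_nonempty : iset !=set0;
  iset_convex : forall x y z : P, iset x -> iset z ->
    val x <= val y -> val y <= val z -> iset y
}.

Section IntervalModule.
Context (R : realType) (P : set R) (K : fieldType) (I : pinterval P).

Definition int_obj (b : bool) : lmodType K :=
  if b then (K^o : lmodType K) else ('rV[K]_0 : lmodType K).

Definition int_map (b c : bool) : {linear int_obj b -> int_obj c} :=
  match b, c return {linear int_obj b -> int_obj c} with
  | true, true => idfun
  | _, _ => \0
  end.

Definition intmod_obj (x : P) : lmodType K := int_obj (x \in (I : set P)).

Definition intmod_tr (x y : P) (_ : val x <= val y) :
  {linear intmod_obj x -> intmod_obj y} :=
  int_map (x \in (I : set P)) (y \in (I : set P)).

Lemma intmod_tr_id (x : P) (h : val x <= val x) (v : intmod_obj x) :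
  intmod_tr h v = v.
Proof.
rewrite /intmod_tr; move: v; rewrite /intmod_obj.
by case: (x \in _) => //= v; rewrite [v]thinmx0.
Qed.

Lemma intmod_tr_comp (x y z : P) (hxy : val x <= val y) (hyz : val y <= val z)
    (hxz : val x <= val z) (v : intmod_obj x) :
  intmod_tr hyz (intmod_tr hxy v) = intmod_tr hxz v.
Proof.
have : x \in (I : set P) -> z \in (I : set P) -> y \in (I : set P).
  rewrite !inE => Ix Iz; exact: iset_convex hxy hyz.
rewrite /intmod_tr; move: v; rewrite /intmod_obj.
case: (x \in _); case: (y \in _); case: (z \in _) => //= v.
by move=> /(_ isT isT).
Qed.

Definition intmod : persmod P K := PersMod intmod_tr_id intmod_tr_comp.

End IntervalModule.

Definition is_interval_module (R : realType) (P : set R) (K : fieldType)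
  (M : persmod P K) : Prop :=
  exists I : pinterval P, isomorphic M (intmod K I).

(* Suprema are taken in the extended reals, since an interval may be unbounded
   or have no supremum in [P]. *)
Definition isup (R : realType) (P : set R) (I : pinterval P) : \bar R :=
  ereal_sup [set (val x)%:E | x in (I : set P)].

Definition isup_mem (R : realType) (P : set R) (I : pinterval P) : Prop :=
  exists2 x : P, (I : set P) x & (val x)%:E = isup I.

Definition same_right_end (R : realType) (P : set R) (I J : pinterval P) :
  Prop :=
  isup I = isup J /\ (isup_mem I <-> isup_mem J).

(* The interval of an interval module is unique, hence it does not matter that
   it is quantified existentially. This never holds for a zero module. *)
Definition same_right_end_mod (R : realType) (P : set R) (K : fieldType)
  (M N : persmod P K) : Prop :=
  exists I J : pinterval P,
    [/\ isomorphic M (intmod K I), isomorphic N (intmod K J)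
      & same_right_end I J].

Record submodule (R : realType) (P : set R) (K : fieldType)
  (M : persmod P K) := Submodule {
  scar : forall x : P, {pred M x};
  scar_closed : forall x : P, submod_closed (@scar x);
  scar_tr : forall (x y : P) (h : val x <= val y) (v : M x),
    v \in @scar x -> ptr M h v \in @scar y
}.

Arguments scar {R P K M} s x.
Arguments scar_closed {R P K M} s x.

Section Submodule.
Context (R : realType) (P : set R) (K : fieldType) (M : persmod P K).

HB.instance Definition _ (S : submodule M) (x : P) :=
  GRing.isSubmodClosed.Build K (M x) (scar S x) (scar_closed S x).

Record sub_obj (S : submodule M) (x : P) : Type := SubObj {
  sub_val : M x;
  _ : sub_val \in scar S x
}.

HB.instance Definition _ (S : submodule M) (x : P) :=
  [isSub for @sub_val S x].
HB.instance Definition _ (S : submodule M) (x : P) :=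
  [Choice of sub_obj S x by <:].
HB.instance Definition _ (S : submodule M) (x : P) :=
  [SubChoice_isSubLmodule of sub_obj S x by <:].

End Submodule.

Section SubPersmod.
Context (R : realType) (P : set R) (K : fieldType) (M : persmod P K).
Context (S : submodule M).

Lemma sub_tr_in (x y : P) (h : val x <= val y) (v : sub_obj S x) :
  ptr M h (val v) \in scar S y.
Proof. by apply: scar_tr; exact: (valP v). Qed.

Definition sub_tr (x y : P) (h : val x <= val y) (v : sub_obj S x) :
  sub_obj S y := SubObj (sub_tr_in h v).

Lemma sub_tr_linear (x y : P) (h : val x <= val y) : linear (sub_tr h).
Proof. by move=> a u v; apply: val_inj; rewrite /= !linearP. Qed.

HB.instance Definition _ (x y : P) (h : val x <= val y) :=
  GRing.isLinear.Build K (sub_obj S x) (sub_obj S y) _ (sub_tr h)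
    (sub_tr_linear h).

Definition sub_ptr (x y : P) (h : val x <= val y) :
  {linear sub_obj S x -> sub_obj S y} := sub_tr h.

Lemma sub_ptr_id (x : P) (h : val x <= val x) (v : sub_obj S x) :
  sub_ptr h v = v.
Proof. by apply: val_inj; rewrite /= ptr_id. Qed.

Lemma sub_ptr_comp (x y z : P) (hxy : val x <= val y) (hyz : val y <= val z)
    (hxz : val x <= val z) (v : sub_obj S x) :
  sub_ptr hyz (sub_ptr hxy v) = sub_ptr hxz v.
Proof. by apply: val_inj; rewrite /= (ptr_comp _ _ hxz). Qed.

Definition submod : persmod P K :=
  @PersMod R P K (sub_obj S) sub_ptr sub_ptr_id sub_ptr_comp.

Definition sub_inc (x : P) : {linear submod x -> M x} :=
  (val : sub_obj S x -> M x).

Lemma incl_nat (x y : P) (h : val x <= val y) (v : submod x) :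
  sub_inc y (ptr submod h v) = ptr M h (sub_inc x v).
Proof. by []. Qed.

Definition incl : pmor submod M := PMor incl_nat.

End SubPersmod.

Definition internal_dsum (R : realType) (P : set R) (K : fieldType)
  (M : persmod P K) (A : finType) (S : A -> submodule M) : Prop :=
  forall (x : P) (v : M x),
    exists! u : forall a, submod (S a) x, \sum_a incl (S a) x (u a) = v.

Section Projection.
Context (R : realType) (P : set R) (K : fieldType) (M : persmod P K).
Context (A : finType) (S : A -> submodule M).
Context (MS : internal_dsum S).

Definition component (x : P) (v : M x) : forall a, submod (S a) x :=
  sval (cid (MS v)).

Lemma component_sum (x : P) (v : M x) :
  \sum_a incl (S a) x (component v a) = v.
Proof. by rewrite /component; case: cid => u [] /=. Qed.

Lemma component_uniq (x : P) (v : M x) (u : forall a, submod (S a) x) :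
  \sum_a incl (S a) x (u a) = v -> component v = u.
Proof. by rewrite /component; case: cid => w [] /= _; apply. Qed.

Context (a : A).

Definition proj_fun (x : P) (v : M x) : submod (S a) x := component v a.

Lemma proj_linear (x : P) : linear (@proj_fun x).
Proof.
move=> c u v; rewrite /proj_fun.
rewrite (@component_uniq _ _ (fun b => c *: component u b + component v b)) //.
under eq_bigr do rewrite linearP.
by rewrite big_split -scaler_sumr !component_sum.
Qed.

HB.instance Definition _ (x : P) :=
  GRing.isLinear.Build K (M x) (submod (S a) x) _ (@proj_fun x)
    (@proj_linear x).

Definition proj_map (x : P) : {linear M x -> submod (S a) x} := @proj_fun x.

Lemma proj_nat (x y : P) (h : val x <= val y) (v : M x) :
  proj_map y (ptr M h v) = ptr (submod (S a)) h (proj_map x v).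
Proof.
rewrite /= /proj_fun.
rewrite (@component_uniq _ _
  (fun b => ptr (submod (S b)) h (component v b))) //.
under eq_bigr do rewrite hmap_nat.
by rewrite -linear_sum component_sum.
Qed.

Definition proj : pmor M (submod (S a)) := PMor proj_nat.

End Projection.

Definition finitely_interval_decomposable (R : realType) (P : set R)
  (K : fieldType) (M : persmod P K) : Prop :=
  exists (A : finType) (S : A -> submodule M),
    internal_dsum S /\ forall a, is_interval_module (submod (S a)).

(* Main.v *)
(* Generators of interval summands with a common right end are nested, and a
   generator may be modified by any generator of a larger interval with the
   same right end. Restricted to such generators, the coefficients of [f] do
   not depend on the point, so they form one scalar matrix [F], which can be
   nonzero only where the source interval is contained in the target interval.
   Evaluating at a point close to the right end, past all summands that end
   earlier, shows that [F] is injective when [f] is. Then [F] can be brought to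
   the form of an injective partial permutation by Gaussian elimination with
   admissible operations only: take the column of the largest remaining
   interval, choose its nonzero entry with the smallest target interval as
   pivot, replace that target generator by the column, and clear the row. *)

From HB Require Import structures.
Require Import Defs.
From mathcomp Require Import all_boot all_order all_algebra.
From mathcomp Require Import boolp classical_sets reals constructive_ereal ereal.

Set Implicit Arguments.
Unset Strict Implicit.
Unset Printing Implicit Defensive.
Import Order.TTheory GRing.Theory Num.Theory.
Local Open Scope ring_scope.

(** * Gaussian elimination over a preorder of labels *)

(** With columns labelled by sources and rows by targets, these are the morphisms of the linearised
    preorder, which is why identities and products stay compatible. *)
Definition compat (K : fieldType) (T : Type) (le : T -> T -> Prop) (q p : nat)
    (g : 'I_q -> T) (h : 'I_p -> T) (X : 'M[K]_(q, p)) : Prop :=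
  forall j i, X j i != 0 -> le (h i) (g j).

Lemma sum_neq0 (V : nmodType) (A : finType) (F : A -> V) :
  \sum_a F a != 0 -> exists a, F a != 0.
Proof.
move=> h; apply/existsP; apply: contraNT h => /existsPn h.
by rewrite big1 // => a _; apply/eqP/negPn/h.
Qed.

Section Elimination.
Context (K : fieldType) (T : Type) (le : T -> T -> Prop).
Hypothesis le_refl : forall x, le x x.
Hypothesis le_trans : forall y x z, le x y -> le y z -> le x z.

Lemma compat_mul q p r (g : 'I_q -> T) (h : 'I_p -> T) (k : 'I_r -> T)
    (X : 'M[K]_(q, p)) (Y : 'M_(p, r)) :
  compat le g h X -> compat le h k Y -> compat le g k (X *m Y).
Proof.
move=> cX cY j i; rewrite mxE => /sum_neq0[a].
by rewrite mulf_eq0 negb_or => /andP[/cX ? /cY ?]; apply: le_trans; eassumption.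
Qed.

Lemma compat1 p (h : 'I_p -> T) : compat le h h (1%:M : 'M[K]_p).
Proof. by move=> i j; rewrite mxE; have [->|_] := eqVneq i j; rewrite ?eqxx. Qed.

(** An index with the most indices below it works: anything above it has a larger down-set, hence
    the same one by cardinality. As [le] is only a preorder, maximality is meant up to
    equivalence. *)
Lemma ex_maximal p (h : 'I_p -> T) (Q : pred 'I_p) i0 : Q i0 ->
  exists2 i, Q i & forall k, Q k -> le (h i) (h k) -> le (h k) (h i).
Proof.
pose down i := [set k | `[< le (h k) (h i) >]].
move=> Qi0; case: (@arg_maxnP _ i0 Q (fun i => #|down i|) Qi0) => i Qi imax.
exists i => // k Qk ik.
have sub : down i \subset down k.
  by apply/fintype.subsetP => l; rewrite !inE => li; apply: le_trans ik.
have /eqP e : down i == down k by rewrite eqEcard sub; apply: imax.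
have : k \in down i by rewrite e !inE.
by rewrite !inE.
Qed.

End Elimination.

(** By [le_up] the nonzero entries of a column have comparable row labels, and by [le_down] those of
    a row have comparable column labels; this lets pivots be chosen so that every operation is
    compatible. The inverses [D'] and [C'] are recorded because a change of generators needs both
    directions compatible. *)
Lemma compat_elimination (K : fieldType) (T : Type) (le : T -> T -> Prop)
    (le_refl : forall x, le x x)
    (le_trans : forall y x z, le x y -> le y z -> le x z)
    (le_up : forall x y z, le x y -> le x z -> le y z \/ le z y)
    (le_down : forall x y z, le y x -> le z x -> le y z \/ le z y)
    (q p : nat) (g : 'I_q -> T) (h : 'I_p -> T) (F : 'M[K]_(q, p)) :
  compat le g h F -> (forall u : 'cV_p, F *m u = 0 -> u = 0) ->
  exists (D D' : 'M_q) (C C' : 'M_p) (s : 'I_p -> 'I_q),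
    [/\ compat le g g D /\ compat le g g D', compat le h h C /\ compat le h h C',
        D' *m D = 1%:M /\ C *m C' = 1%:M, injective s
      & forall j i, (D *m F *m C) j i = (j == s i)%:R].
Proof.
move=> cF kF.
(* [U] collects the finished columns: each is a unit vector with its 1 in row [s i], and the row of
   a finished column vanishes on all unfinished ones. *)
have key n : (n <= p)%N -> exists (D D' : 'M_q) (C C' : 'M_p) (s : 'I_p -> 'I_q)
    (U : {set 'I_p}),
    [/\ compat le g g D /\ compat le g g D', compat le h h C /\ compat le h h C',
        D' *m D = 1%:M /\ C *m C' = 1%:M, #|U| = n
      & (forall j i, i \in U -> (D *m F *m C) j i = (j == s i)%:R) /\
        (forall i k, i \notin U -> k \in U -> (D *m F *m C) (s k) i = 0)].
  elim: n => [_|n IH np].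
    (* [s] must be total even while [U] is empty. Without rows, injectivity forces [p] to be 0 and
       [s] is the empty function; otherwise [ord0] is a default value. *)
    case: q g F cF kF => [|q'] g' F cF kF.
      have e0 (u : 'cV[K]_p) : u = 0 by apply: kF; apply/matrixP=> -[].
      have p0 (i : 'I_p) : False.
        have /matrixP/(_ i 0) := e0 (const_mx 1).
        by rewrite !mxE => /eqP; rewrite oner_eq0.
      exists 1%:M, 1%:M, 1%:M, 1%:M, (fun i => match p0 i with end), finset.set0.
      split; [by split; apply: compat1|by split; apply: compat1|
              by rewrite !mulmx1|by rewrite cards0|].
      by split=> j i; rewrite !inE.
    exists 1%:M, 1%:M, 1%:M, 1%:M, (fun=> ord0), finset.set0.
    split; [by split; apply: compat1|by split; apply: compat1|
            by rewrite !mulmx1|by rewrite cards0|].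
    by split=> j i; rewrite !inE.
  have [D [D' [C [C' [s [U [[cD cD'] [cC cC'] [DD CC] Un [GU Gs]]]]]]]] := IH (ltnW np).
  have [G GD] : exists G, D *m F *m C = G by exists (D *m F *m C).
  rewrite GD in GU Gs.
  have cG : compat le g h G by rewrite -GD; apply: compat_mul cC => //; apply: compat_mul cF.
  have kG (u : 'cV[K]_p) : G *m u = 0 -> u = 0.
    move=> Gu; have : C *m u = 0.
      apply: kF; rewrite -[LHS]mul1mx -DD -mulmxA.
      have -> : D *m (F *m (C *m u)) = G *m u by rewrite -GD !mulmxA.
      by rewrite Gu mulmx0.
    by move=> Cu; rewrite -[u]mul1mx -(mulmx1C CC) -mulmxA Cu mulmx0.
  have [i0 i0U] : exists i, i \notin U.
    apply/existsP; rewrite -negb_forall; apply/negP => /forallP Uall.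
    have : #|U| = p by rewrite -[RHS]card_ord; apply: eq_card => i; rewrite Uall.
    by move=> e; move: np; rewrite -e Un ltnn.
  have [i iU imax] := ex_maximal le_refl le_trans h (Q := [pred i | i \notin U]) i0U.
  have [j0 j0P] : exists j, G j i != 0.
    apply/existsP; rewrite -negb_forall; apply/negP => /forallP Gall.
    have : G *m delta_mx i 0 = 0 :> 'cV_q.
      by rewrite -colE; apply/colP => j; rewrite !mxE; apply/eqP/Gall.
    by move/kG/matrixP/(_ i 0); rewrite !mxE !eqxx => /eqP; rewrite oner_eq0.
  have [j Gj jmin] := @ex_maximal _ (fun x y => le y x) le_refl
    (fun y x z xy yz => le_trans _ _ _ yz xy) _ g [pred j | G j i != 0] _ j0P.
  rewrite /= in Gj iU imax jmin.
  (* Rows already used vanish on the unfinished column [i], so the pivot row is a new one. *)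
  have jU k : k \in U -> j == s k = false.
    by move=> kU; apply/eqP => e; rewrite e Gs ?eqxx in Gj.
  have jle k : G k i != 0 -> le (g j) (g k).
    by move=> Gk; case: (le_up _ _ _ (cG _ _ Gj) (cG _ _ Gk)) => //; apply: jmin.
  (* [D1'] is the identity with column [j] replaced by column [i] of [G]. Its inverse [D1] comes
     from the rank-one update formula, whose denominator 1 + [e *m w] is the pivot [G j i]. *)
  pose w := col i G - delta_mx j 0.
  pose e : 'rV[K]_q := delta_mx 0 j.
  have ew : e *m w = (G j i - 1)%:M.
    by rewrite -rowE; apply/matrixP=> a b; rewrite !ord1 !mxE !eqxx.
  pose D1 := 1%:M - (G j i)^-1 *: (w *m e).
  pose D1' := 1%:M + w *m e.
  have wE a b : (w *m e) a b = (G a i - (a == j)%:R) * (b == j)%:R.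
    by rewrite !mxE big_ord1 !mxE !eqxx /= andbT.
  have wc a : w a 0 = G a i - (a == j)%:R by rewrite !mxE eqxx andbT.
  have eG : e *m G = row j G by rewrite -rowE.
  clearbody w e.
  have cD1 : compat le g g D1.
    move=> a b; rewrite 2!mxE [X in _ + X]mxE [X in - X]mxE wE.
    have [->|ab] := eqVneq a b; first by [].
    rewrite add0r oppr_eq0 mulf_eq0 negb_or mulf_eq0 negb_or.
    move=> /andP[_ /andP[]]; have [->|_] := eqVneq b j; last by rewrite eqxx.
    by have [->|_] := eqVneq a j => //; rewrite subr0 => /jle.
  have cD1' : compat le g g D1'.
    move=> a b; rewrite mxE [X in X + _]mxE wE.
    have [->|ab] := eqVneq a b; first by [].
    rewrite add0r mulf_eq0 negb_or.
    move=> /andP[]; have [->|_] := eqVneq b j; last by rewrite eqxx.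
    by have [->|_] := eqVneq a j => //; rewrite subr0 => /jle.
  have DD1 : D1' *m D1 = 1%:M.
    rewrite /D1 /D1' mulmxBr mulmx1 -scalemxAr mulmxDl mul1mx.
    rewrite -[w *m e *m _]mulmxA [e *m _]mulmxA ew mul_scalar_mx -scalemxAr.
    rewrite -[X in _ *: (X + _)]scale1r -scalerDl scalerA.
    by rewrite [X in _ * X]addrC subrK mulVf // scale1r addrK.
  have [G1 G1D] : exists G1, D1 *m G = G1 by exists (D1 *m G).
  have G1E a b : G1 a b = G a b - (G j i)^-1 * (G a i - (a == j)%:R) * G j b.
    rewrite -G1D mulmxBl mul1mx -scalemxAl -mulmxA eG mxE [X in _ + X]mxE.
    by rewrite [X in - X]mxE mxE big_ord1 wc [X in _ * (_ * X)]mxE mulrA.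
  have G1i a : G1 a i = (a == j)%:R.
    by rewrite G1E mulrAC mulVf // mul1r opprB addrC subrK.
  have G1U a k : k \in U -> G1 a k = (a == s k)%:R.
    by move=> kU; rewrite G1E [G a k]GU // [G j k]GU // jU // mulr0 subr0.
  have G1s b k : k \in U -> G1 (s k) b = G (s k) b.
    by move=> kU; rewrite G1E [G (s k) i]Gs // [s k == j]eq_sym jU // subr0 mulr0 mul0r subr0.
  have cG1 : compat le g h G1 by rewrite -G1D; apply: compat_mul cG.
  (* Right multiplication by [C1] subtracts multiples of column [i] so as to clear row [j]
     elsewhere. The pivot is now 1, so [t *m d] is zero and the inverse only flips a sign. *)
  pose t := row j G1 - delta_mx 0 i.
  pose d : 'cV[K]_p := delta_mx i 0.
  pose C1 := 1%:M - d *m t.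
  pose C1' := 1%:M + d *m t.
  have td : t *m d = 0.
    by rewrite -colE; apply/matrixP=> a b; rewrite !ord1 !mxE G1i !eqxx subrr.
  have CC1 : C1 *m C1' = 1%:M.
    rewrite /C1 /C1' mulmxBl mul1mx [_ *m (1%:M + _)]mulmxDr mulmx1.
    by rewrite -[d *m t *m _]mulmxA [t *m (_ *m _)]mulmxA td mul0mx mulmx0 addr0 addrK.
  have tE a b : (d *m t) a b = (a == i)%:R * (G1 j b - (b == i)%:R).
    by rewrite !mxE big_ord1 !mxE eqxx /= andbT.
  have tr b : t 0 b = G1 j b - (b == i)%:R by rewrite !mxE.
  have G1d : G1 *m d = col i G1 by rewrite -colE.
  clearbody t d.
  have cdt a b : a != b -> (d *m t) a b != 0 -> le (h b) (h a).
    move=> ab; rewrite tE mulf_eq0 negb_or.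
    have [->|_ /andP[]] := eqVneq a i; last by rewrite eqxx.
    have [->|bi] := eqVneq b i; first by [].
    rewrite subr0 => /andP[_ Gjb].
    (* Finished columns are zero in row [j], so [b] is unfinished and the maximality of [i]
       applies. *)
    have bU : b \notin U by apply: contraNN Gjb => bU; rewrite G1U // jU.
    by case: (le_down _ _ _ (cG _ _ Gj) (cG1 _ _ Gjb)) => // /imax; apply.
  have cC1 : compat le h h C1.
    move=> a b; rewrite 2!mxE [X in _ + X]mxE; have [->|ab] := eqVneq a b; first by [].
    by rewrite add0r oppr_eq0; apply: cdt.
  have cC1' : compat le h h C1'.
    move=> a b; rewrite mxE [X in X + _]mxE; have [->|ab] := eqVneq a b; first by [].
    by rewrite add0r; apply: cdt.
  exists (D1 *m D), (D' *m D1'), (C *m C1), (C1' *m C'),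
    (fun k => if k == i then j else s k), (i |: U).
  have -> : D1 *m D *m F *m (C *m C1) = G1 *m C1 by rewrite -G1D -GD !mulmxA.
  have G2E a b : (G1 *m C1) a b = G1 a b - (a == j)%:R * (G1 j b - (b == i)%:R).
    rewrite /C1 mulmxBr mulmx1 mulmxA G1d mxE [X in _ + X]mxE mxE big_ord1.
    by rewrite [X in X * _]mxE G1i tr.
  split.
  - by split; [exact: compat_mul cD1 cD|exact: compat_mul cD' cD1'].
  - by split; [exact: compat_mul cC cC1|exact: compat_mul cC1' cC'].
  - split; first by rewrite mulmxA -[D' *m _ *m _]mulmxA DD1 mulmx1.
    by rewrite mulmxA -[C *m _ *m _]mulmxA CC1 mulmx1.
  - by rewrite cardsU1 iU Un.
  split=> [a b|b k].
    rewrite !inE; have [-> _|bi /= bU] := eqVneq b i.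
      by rewrite G2E !G1i !eqxx subrr mulr0 subr0.
    by rewrite G2E (negPf bi) !G1U // jU // subr0 mulr0 subr0.
  rewrite !inE negb_or => /andP[bi bU].
  have [-> _|ki /= kU] := eqVneq k i.
    by rewrite G2E eqxx mul1r (negPf bi) subr0 subrr.
  by rewrite G2E [s k == j]eq_sym jU // mul0r subr0 G1s // Gs.
have [D [D' [C [C' [s [U [cD cC [DD CC] Up [GU _]]]]]]]] := key p (leqnn p).
have UT i : i \in U.
  have /eqP -> : U == finset.setT by rewrite eqEcard finset.subsetT cardsT card_ord Up /=.
  by rewrite inE.
exists D, D', C, C', s; split=> // [i k sik|j i]; last exact: GU.
(* If [s i = s k], columns [i] and [k] of the reduced matrix agree, so the difference of the two
   unit vectors is killed; injectivity of [F] then gives [i = k]. *)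
pose u : 'cV[K]_p := delta_mx i 0 - delta_mx k 0.
have /kF : F *m (C *m u) = 0.
  rewrite -[LHS]mul1mx -DD -mulmxA.
  have -> : D *m (F *m (C *m u)) = D *m F *m C *m u by rewrite !mulmxA.
  suff -> : D *m F *m C *m u = 0 by rewrite mulmx0.
  rewrite mulmxBr -!colE; apply/eqP; rewrite subr_eq0; apply/eqP/colP => j.
  by rewrite mxE [RHS]mxE !GU // sik.
move/(congr1 (mulmx C')); rewrite mulmxA (mulmx1C CC) mul1mx mulmx0 => /matrixP/(_ i 0).
rewrite !mxE !eqxx /= andbT; have [//|_ /eqP] := eqVneq i k.
by rewrite subr0 oner_eq0.
Qed.

Local Open Scope classical_set_scope.

(** * Intervals with a common right end *)

Section Intervals.
Context (R : realType) (P : set R).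
Implicit Types (I J L : pinterval P).

(** Expresses that [I] ends no later than [J] without mentioning suprema. *)
Definition cofinal I J : Prop :=
  forall x, (I : set P) x -> exists2 y, (J : set P) y & val x <= val y.

(** A point [x] of [I] with nothing of [J] at or above it would be the common supremum, attained in
    [I] and hence in [J], although all of [J] lies strictly below [x]. *)
Lemma same_right_end_cofinal I J : same_right_end I J -> cofinal I J.
Proof.
case=> eqs mems x Ix; apply: contrapT => nJ.
have Jlt y : (J : set P) y -> val y < val x.
  by move=> Jy; rewrite ltNge; apply/negP => xy; apply: nJ; exists y.
have supI : (val x)%:E = isup I.
  apply/le_anti/andP; split; first by apply: ereal_sup_ubound; exists x.
  rewrite eqs; apply: ge_ereal_sup => _ [y Jy <-].
  by rewrite lee_fin ltW // Jlt.
have [y Jy] := mems.1 (ex_intro2 _ _ x Ix supI).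
by rewrite -eqs -supI => yx; have := Jlt _ Jy; rewrite -lte_fin yx ltxx.
Qed.

Lemma cofinal_isup I J : cofinal I J -> (isup I <= isup J)%E.
Proof.
move=> IJ; apply: ge_ereal_sup => _ [x /IJ[y Jy xy] <-].
by apply: (@le_trans _ _ (val y)%:E); [rewrite lee_fin|apply: ereal_sup_ubound; exists y].
Qed.

Lemma cofinal_isup_mem I J : cofinal I J -> isup I = isup J ->
  isup_mem I -> isup_mem J.
Proof.
move=> IJ e [x Ix xs]; have [y Jy xy] := IJ _ Ix; exists y => //.
apply/le_anti/andP; split; first by apply: ereal_sup_ubound; exists y.
by rewrite -e -xs lee_fin.
Qed.

Lemma same_right_endP I J : same_right_end I J <-> cofinal I J /\ cofinal J I.
Proof.
split=> [[e m]|[IJ JI]].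
  by split; apply: same_right_end_cofinal; split=> //; apply: iff_sym.
have e : isup I = isup J by apply/le_anti; rewrite !cofinal_isup.
by split=> //; split; apply: cofinal_isup_mem.
Qed.

Lemma sre_sym I J : same_right_end I J -> same_right_end J I.
Proof. by case=> e m; split=> //; apply: iff_sym. Qed.

Lemma sre_trans J I L : same_right_end I J -> same_right_end J L ->
  same_right_end I L.
Proof. by case=> e m [e' m']; split; [rewrite e|apply: iff_trans m m']. Qed.

(** Intervals with the same right end can differ only on the left: some point of [J] lies above [y],
    and convexity does the rest. *)
Lemma sre_mem I J x y : same_right_end I J -> (I : set P) y -> (J : set P) x ->
  val x <= val y -> (J : set P) y.
Proof.
move=> /same_right_end_cofinal IJ Iy Jx xy; have [z Jz yz] := IJ _ Iy.
exact: iset_convex Jx Jz xy yz.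
Qed.

Lemma sre_total I J : same_right_end I J -> I `<=` J \/ J `<=` I.
Proof.
move=> IJ; have [|/existsNP[x /not_implyP[Ix nJx]]] := pselect (I `<=` J); first by left.
right=> y Jy; have [xy|/ltW yx] := leP (val x) (val y).
  exact: sre_mem (sre_sym IJ) Jy Ix xy.
by case: nJx; apply: sre_mem IJ Ix Jy yx.
Qed.

(** For intervals with the same right end, containment is exactly the condition for a nonzero
    morphism from the interval module of [I] to that of [J]. *)
Definition sre_le I J : Prop := same_right_end I J /\ I `<=` J.

Lemma sre_le_refl I : sre_le I I. Proof. by split. Qed.

Lemma sre_le_trans J I L : sre_le I J -> sre_le J L -> sre_le I L.
Proof. by case=> IJ sIJ [JL sJL]; split; [apply: sre_trans JL|apply: subset_trans sJL]. Qed.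

Lemma sre_le_total I J : same_right_end I J -> sre_le I J \/ sre_le J I.
Proof.
by move=> IJ; case: (sre_total IJ); [left|right; split=> //; apply: sre_sym].
Qed.

Lemma sre_le_up I J L : sre_le I J -> sre_le I L -> sre_le J L \/ sre_le L J.
Proof.
by move=> [IJ _] [IL _]; apply: sre_le_total; apply: sre_trans IL; apply: sre_sym.
Qed.

Lemma sre_le_down I J L : sre_le J I -> sre_le L I -> sre_le J L \/ sre_le L J.
Proof.
by move=> [IJ _] [IL _]; apply: sre_le_total; apply: sre_trans IJ _; apply: sre_sym.
Qed.

(** Allows finitely many conditions that hold near the right end to be met at a single point. *)
Lemma interval_upper_bound I (A : finType) (z : A -> P) :
  (forall a, (I : set P) (z a)) ->
  exists2 x, (I : set P) x & forall a, val (z a) <= val x.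
Proof.
move=> Iz; suff [x Ix xz] : exists2 x, (I : set P) x &
    forall a, a \in enum A -> val (z a) <= val x.
  by exists x => // a; apply: xz; rewrite mem_enum.
elim: (enum A) => [|a s [x Ix xz]]; first by have [x Ix] := iset_nonempty I; exists x.
have [ax|/ltW xa] := leP (val (z a)) (val x).
  by exists x => // b; rewrite inE => /orP[/eqP->//|/xz].
exists (z a) => // b; rewrite inE => /orP[/eqP->//|/xz bx].
exact: le_trans bx xa.
Qed.

End Intervals.

(** * Bases made of interval generators, and their changes *)

Section Sections.
Context (R : realType) (P : set R) (K : fieldType).
Implicit Types (M N : persmod P K) (I : pinterval P).

(* A family of this kind is the same thing as a morphism [intmod K I -> M]; it
   stands for a generator even if [I] has no least element. *)
Definition is_section M I (m : forall x, M x) : Prop :=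
  (forall x, ~ (I : set P) x -> m x = 0) /\
  (forall x y (h : val x <= val y), (I : set P) x -> ptr M h (m x) = m y).

Definition combo M p (m : 'I_p -> forall x, M x) (x : P) (c : 'cV[K]_p) : M x :=
  \sum_i c i 0 *: m i x.

(** A generator vanishes off its interval, so coordinates at [x] become unique only once restricted
    to the generators alive at [x]. *)
Definition supported p (I : 'I_p -> pinterval P) (x : P) (c : 'cV[K]_p) : Prop :=
  forall i, c i 0 != 0 -> (I i : set P) x.

Definition interval_basis M p (I : 'I_p -> pinterval P)
    (m : 'I_p -> forall x, M x) : Prop :=
  [/\ forall i, is_section (I i) (m i),
      forall x v, exists2 c, supported I x c & v = combo m x c
    & forall x c, supported I x c -> combo m x c = 0 -> c = 0].

Lemma combo_is_linear M p (m : 'I_p -> forall x, M x) x : linear (combo m x).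
Proof.
move=> k c d; rewrite /combo scaler_sumr -big_split; apply: eq_bigr => i _.
by rewrite !mxE scalerDl scalerA.
Qed.

HB.instance Definition _ M p (m : 'I_p -> forall x, M x) x :=
  GRing.isLinear.Build K _ _ _ (combo m x) (combo_is_linear m x).

Lemma combo_delta M p (m : 'I_p -> forall x, M x) x i :
  combo m x (delta_mx i 0) = m i x.
Proof.
rewrite /combo (bigD1 i) //= !mxE !eqxx scale1r big1 ?addr0 // => k /negPf ki.
by rewrite !mxE ki scale0r.
Qed.

Lemma supported_delta p (I : 'I_p -> pinterval P) x i :
  (I i : set P) x -> supported I x (delta_mx i 0).
Proof. by move=> Ix k; rewrite !mxE andbT; have [->|] := eqVneq k i; rewrite ?eqxx. Qed.

Lemma supportedB p (I : 'I_p -> pinterval P) x c d :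
  supported I x c -> supported I x d -> supported I x (c - d).
Proof.
move=> sc sd i; rewrite !mxE; have [c0|/sc //] := eqVneq (c i 0) 0.
by rewrite c0 add0r oppr_eq0 => /sd.
Qed.

Lemma supported_mul p q (I : 'I_p -> pinterval P) (J : 'I_q -> pinterval P)
    (X : 'M_(q, p)) x c :
  compat (@sre_le R P) J I X -> supported I x c -> supported J x (X *m c).
Proof.
move=> cX sc j; rewrite mxE => /sum_neq0[i]; rewrite mulf_eq0 negb_or => /andP[].
by move=> /cX[_ IJ] /sc /IJ.
Qed.

Lemma interval_basis_inj M p (I : 'I_p -> pinterval P) (m : 'I_p -> forall x, M x) :
  interval_basis I m -> forall x c d, supported I x c -> supported I x d ->
  combo m x c = combo m x d -> c = d.
Proof.
case=> _ _ free x c d sc sd e; apply/subr0_eq/(free x); first exact: supportedB.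
by rewrite linearB /= e subrr.
Qed.

Lemma interval_basis_neq0 M p (I : 'I_p -> pinterval P) (m : 'I_p -> forall x, M x) :
  interval_basis I m -> forall i x, (I i : set P) x -> m i x != 0.
Proof.
case=> _ _ free i x Ix; apply/eqP => m0.
have := free x _ (supported_delta Ix); rewrite combo_delta => /(_ m0)/colP/(_ i).
by rewrite !mxE !eqxx => /eqP; rewrite oner_eq0.
Qed.

(** For a compatible [C], column [i] mixes generators of intervals containing [I i], which may start
    earlier; the cut-off makes the combination live on [I i] only. *)
Definition change_basis M p (I : 'I_p -> pinterval P) (m : 'I_p -> forall x, M x)
    (C : 'M[K]_p) (i : 'I_p) (x : P) : M x :=
  if `[< (I i : set P) x >] then combo m x (col i C) else 0.

Lemma combo_change_basis M p (I : 'I_p -> pinterval P) (m : 'I_p -> forall x, M x)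
    (C : 'M[K]_p) x c :
  supported I x c -> combo (change_basis I m C) x c = combo m x (C *m c).
Proof.
move=> sc; transitivity (\sum_i c i 0 *: combo m x (col i C)).
  apply: eq_bigr => i _; have [->|/sc Ix] := eqVneq (c i 0) 0; first by rewrite !scale0r.
  by rewrite /change_basis; case: asboolP.
have -> : C *m c = \sum_i c i 0 *: col i C.
  apply/colP => k; rewrite mxE summxE; apply: eq_bigr => i _.
  by rewrite !mxE mulrC.
by rewrite linear_sum; apply: eq_bigr => i _; rewrite linearZ.
Qed.

Lemma interval_basis_change M p (I : 'I_p -> pinterval P) (m : 'I_p -> forall x, M x)
    (C C' : 'M[K]_p) :
  compat (@sre_le R P) I I C -> compat (@sre_le R P) I I C' -> C *m C' = 1%:M ->
  interval_basis I m -> interval_basis I (change_basis I m C).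
Proof.
move=> cC cC' CC' [sec gen free]; split=> [i|x v|x c sc].
- split=> [x nIx|x y h Ix]; first by rewrite /change_basis; case: asboolP.
  rewrite {1}/change_basis; case: asboolP => // _.
  rewrite /combo linear_sum /=.
  have -> : \sum_k ptr M h (col i C k 0 *: m k x) = combo m y (col i C).
    apply: eq_bigr => k _; rewrite linearZ /= mxE.
    have [->|/cC[_ IJ]] := eqVneq (C k i) 0; first by rewrite !scale0r.
    by rewrite (sec k).2 //; apply: IJ.
  (* Here [y] comes after [x] and outside [I i], so it is past the common right end of all intervals
     involved and every term vanishes. *)
  rewrite /change_basis; case: asboolP => // nIy.
  rewrite /combo big1 // => k _; rewrite mxE.
  have [->|/cC[IJ _]] := eqVneq (C k i) 0; first by rewrite !scale0r.
  rewrite (sec k).1 ?scaler0 // => Iy; apply: nIy.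
  exact: sre_mem (sre_sym IJ) Iy Ix h.
- have [c sc ->] := gen x v; exists (C' *m c); first exact: supported_mul sc.
  by rewrite combo_change_basis ?mulmxA ?CC' ?mul1mx //; apply: supported_mul sc.
rewrite combo_change_basis // => /free Cc.
by rewrite -[c]mul1mx -(mulmx1C CC') -mulmxA Cc ?mulmx0 //; apply: supported_mul sc.
Qed.

End Sections.

(** * Passing between interval summands and generators *)

Section Generators.
Context (R : realType) (P : set R) (K : fieldType).
Implicit Types (L M N : persmod P K) (I : pinterval P).

Section Kernel.
Context M N (f : pmor M N).

Definition ker_pred (x : P) : {pred M x} := [pred v | f x v == 0].

Lemma ker_closed x : submod_closed (@ker_pred x).
Proof.
split=> [|a u v]; rewrite !inE ?linear0 //.
by move=> /eqP fu /eqP fv; rewrite linearP fu fv scaler0 addr0.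
Qed.

Lemma ker_tr x y (h : val x <= val y) (v : M x) :
  v \in @ker_pred x -> ptr M h v \in @ker_pred y.
Proof. by rewrite !inE => /eqP fv; rewrite hmap_nat fv linear0. Qed.

Definition ker : submodule M := Submodule ker_closed ker_tr.

End Kernel.

(** The test object is the kernel of [f]: its inclusion and the zero morphism agree after composing
    with [f]. *)
Lemma mono_eq0 M N (f : pmor M N) : mono f -> forall x v, f x v = 0 -> v = 0.
Proof.
move=> mf x v fv; have vk : v \in scar (ker f) x by rewrite inE fv.
apply: (mf _ (incl (ker f)) (zero_hom _ _) _ x (SubObj vk)) => y [w /= wk].
by rewrite linear0; apply/eqP; move: wk; rewrite inE.
Qed.

Lemma mono_ker0 M N (f : pmor M N) : (forall x v, f x v = 0 -> v = 0) -> mono f.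
Proof.
move=> f0 L g h gh x v; apply/subr0_eq/f0.
by rewrite linearB; apply/eqP; rewrite subr_eq0; apply/eqP/(gh x v).
Qed.

Lemma bijective_isomorphic L M (g : pmor L M) :
  (forall x v, g x v = 0 -> v = 0) -> (forall x w, exists v, g x v = w) ->
  isomorphic M L.
Proof.
move=> g0 gsurj.
have ginj x : injective (g x).
  by move=> u v e; apply/subr0_eq/g0; rewrite linearB /= e subrr.
pose k x w := sval (cid (gsurj x w)).
have gk x w : g x (k x w) = w by rewrite /k; case: cid.
have klin x : linear (k x) by move=> a u v; apply: ginj; rewrite linearP !gk.
pose kl x : {linear M x -> L x} :=
  HB.pack (k x) (GRing.isLinear.Build K _ _ _ (k x) (klin x)).
have knat x y (h : val x <= val y) (w : M x) : kl y (ptr M h w) = ptr L h (kl x w).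
  by apply: ginj; rewrite hmap_nat !gk.
exists (PMor knat), g; split=> x v; first exact: gk.
by apply: ginj; apply: gk.
Qed.

Definition int_one (b : bool) : int_obj K b :=
  match b with true => (1 : K^o) | false => 0 end.

Definition int_coef (b : bool) : int_obj K b -> K :=
  match b with true => id | false => fun=> 0 end.

Lemma int_coef_is_linear b : linear_for *%R (@int_coef b).
Proof. by case: b => // a u v /=; rewrite mulr0 addr0. Qed.

Lemma int_coefK b (v : int_obj K b) : int_coef v *: int_one b = v.
Proof. by case: b v => [v|v]; rewrite /= ?scale0r; [apply: mulr1|rewrite [v]thinmx0]. Qed.

Lemma int_one0 b : b = false -> int_one b = 0. Proof. by move->. Qed.

Lemma int_one_neq0 (b : bool) : b -> int_one b != 0.
Proof. by move=> ->; apply: oner_neq0. Qed.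

Lemma int_coef_one (b : bool) : b -> int_coef (int_one b) = 1. Proof. by move->. Qed.

Lemma int_map_one (b c : bool) : b -> int_map K b c (int_one b) = int_one c.
Proof. by move->; case: c. Qed.

Lemma int_coef_map (b c : bool) v : b -> c -> int_coef (int_map K b c v) = int_coef v.
Proof. by case: b v; case: c. Qed.

Definition intmod_one I (x : P) : intmod K I x := int_one (x \in (I : set P)).

Lemma intmod_one_section I : is_section I (intmod_one I).
Proof.
split=> [x nIx|x y h Ix]; first by apply: int_one0; rewrite memNset.
by apply: int_map_one; rewrite mem_set.
Qed.

Lemma intmod_one_neq0 I x : (I : set P) x -> intmod_one I x != 0.
Proof. by move=> Ix; apply: int_one_neq0; rewrite mem_set. Qed.

Lemma hom_section M N (f : pmor M N) I (m : forall x, M x) :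
  is_section I m -> is_section I (fun x => f x (m x)).
Proof.
case=> m0 mtr; split=> [x nIx|x y h Ix]; first by rewrite m0 // linear0.
by rewrite -hmap_nat mtr.
Qed.

Lemma intmod_eq0 I x (v : intmod K I x) : ~ (I : set P) x -> v = 0.
Proof.
by move=> nIx; rewrite -[LHS]int_coefK -/(intmod_one I x)
  (intmod_one_section I).1 // scaler0.
Qed.

Lemma int_coef0 b : int_coef (0 : int_obj K b) = 0. Proof. by case: b. Qed.

Section SectionHom.
Context M I (m : forall x, M x) (ms : is_section I m).

Definition section_fun (x : P) (v : intmod K I x) : M x := int_coef v *: m x.

Lemma section_fun_linear x : linear (@section_fun x).
Proof. by move=> a u v; rewrite /section_fun int_coef_is_linear scalerDl scalerA. Qed.

HB.instance Definition _ x :=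
  GRing.isLinear.Build K _ _ _ (@section_fun x) (@section_fun_linear x).

Definition section_map (x : P) : {linear intmod K I x -> M x} := @section_fun x.

Lemma section_nat x y (h : val x <= val y) (v : intmod K I x) :
  section_map y (ptr (intmod K I) h v) = ptr M h (section_map x v).
Proof.
rewrite /= /section_fun linearZ /=; have [Ix|nIx] := pselect ((I : set P) x).
  rewrite ms.2 //; have [Iy|nIy] := pselect ((I : set P) y); last by rewrite ms.1 ?scaler0.
  by congr (_ *: _); apply: int_coef_map; rewrite mem_set.
by rewrite (intmod_eq0 v nIx) linear0 !int_coef0 !scale0r.
Qed.

Definition section_hom : pmor (intmod K I) M := PMor section_nat.

End SectionHom.

Lemma isomorphic_section L I (s : forall x, L x) :
  is_section I s -> (forall x, (I : set P) x -> s x != 0) ->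
  (forall x v, exists c, v = c *: s x) -> isomorphic L (intmod K I).
Proof.
move=> ss sn0 sgen; apply: (@bijective_isomorphic _ _ (section_hom ss)) => x v.
  move=> /eqP; rewrite /= /section_fun scaler_eq0.
  have [Ix|nIx _] := pselect ((I : set P) x).
    by rewrite (negPf (sn0 _ Ix)) orbF => /eqP e; rewrite -[LHS]int_coefK e scale0r.
  exact: intmod_eq0.
have [c ->] := sgen x v; have [Ix|nIx] := pselect ((I : set P) x); last first.
  by exists 0; rewrite linear0 ss.1 // scaler0.
exists (c *: intmod_one I x); rewrite linearZ /= /section_fun.
suff -> : int_coef (intmod_one I x) = 1 by rewrite scale1r.
by apply: int_coef_one; rewrite mem_set.
Qed.

(** The interval is the support of the module, so it is an isomorphism invariant. *)
Lemma isomorphic_intmod_neq0 L I x :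
  isomorphic L (intmod K I) -> (I : set P) x <-> exists v : L x, v != 0.
Proof.
case=> f [g [gf fg]].
have gfK x' w : g x' (f x' w) = w by exact: gf.
have fgK x' w : f x' (g x' w) = w by exact: fg.
split=> [Ix|[v v0]].
  exists (g x (intmod_one I x)); apply: contraNN (intmod_one_neq0 Ix) => /eqP e.
  by apply/eqP; rewrite -[LHS]fgK e linear0.
apply: contrapT => nIx; case/eqP: v0; rewrite -[LHS]gfK.
by rewrite (intmod_eq0 (f x v) nIx) linear0.
Qed.

(** Replaces the existentially quantified intervals by any chosen ones. Mutual cofinality depends
    only on which points belong to the intervals, so it transfers. *)
Lemma same_right_end_modP L M I (J : pinterval P) :
  isomorphic L (intmod K I) -> isomorphic M (intmod K J) ->
  same_right_end_mod L M <-> same_right_end I J.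
Proof.
move=> LI MJ; split=> [[I' [J' [LI' MJ' IJ]]]|IJ]; last by exists I, J.
have II' x : (I : set P) x <-> (I' : set P) x.
  by rewrite (isomorphic_intmod_neq0 x LI) (isomorphic_intmod_neq0 x LI').
have JJ' x : (J : set P) x <-> (J' : set P) x.
  by rewrite (isomorphic_intmod_neq0 x MJ) (isomorphic_intmod_neq0 x MJ').
have /same_right_endP[cIJ cJI] := IJ.
apply/same_right_endP; split=> x.
  by move=> /II'/cIJ[y /JJ' Jy xy]; exists y.
by move=> /JJ'/cJI[y /II' Iy xy]; exists y.
Qed.

(** The generator is the image of 1 under an isomorphism. Interval and generator form one pair so
    that [choice] can pick both for all summands at once. *)
Lemma interval_module_generator M (S : submodule M) :
  is_interval_module (submod S) ->
  exists Im : pinterval P * (forall x, M x),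
    [/\ is_section Im.1 Im.2, forall x, (Im.1 : set P) x -> Im.2 x != 0,
        forall x, Im.2 x \in scar S x
      & forall x (v : submod S x), exists2 c, (c != 0 -> (Im.1 : set P) x) &
          incl S x v = c *: Im.2 x].
Proof.
case=> I [f [g [gf fg]]].
have gfK x' w : g x' (f x' w) = w by exact: gf.
have fgK x' w : f x' (g x' w) = w by exact: fg.
pose m x := incl S x (g x (intmod_one I x)).
exists (I, m); split=> [|x Ix|x|x v] /=.
- exact: (hom_section (incl S) (hom_section g (intmod_one_section I))).
- apply: contraNN (intmod_one_neq0 Ix) => /eqP e; apply/eqP.
  rewrite -[LHS]fgK (_ : g x _ = 0) ?linear0 //.
  by apply: val_inj; exact: e.
- exact: (valP (g x (intmod_one I x))).
pose c := int_coef (f x v); exists (if `[< (I : set P) x >] then c else 0).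
  by case: asboolP; rewrite ?eqxx.
have e : incl S x v = c *: m x.
  by rewrite /m -linearZ; congr (incl S x _); rewrite -linearZ /= int_coefK gfK.
rewrite [LHS]e; case: asboolP => // nIx.
by rewrite /m (intmod_one_section I).1 // !linear0 ?scaler0.
Qed.

Lemma decomposable_basis M : finitely_interval_decomposable M ->
  exists p (I : 'I_p -> pinterval P) (m : 'I_p -> forall x, M x), interval_basis I m.
Proof.
case=> A [S [dS Sint]].
have [Im Imp] := choice (fun a => interval_module_generator (Sint a)).
exists #|A|, (fun i => (Im (enum_val i)).1), (fun i => (Im (enum_val i)).2).
split=> [i|x v|x c sc c0]; first by case: (Imp (enum_val i)).
- have [u [uv _]] := dS x v.
  have /choice[c cp] : forall a, exists c, (c != 0 -> ((Im a).1 : set P) x) /\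
      incl (S a) x (u a) = c *: (Im a).2 x.
    by move=> a; have [_ _ _ /(_ x (u a))[c]] := Imp a; exists c.
  exists (\col_i c (enum_val i)) => [i|]; first by rewrite mxE; apply: (cp _).1.
  rewrite -uv /combo; rewrite (eq_bigr (fun a => c a *: (Im a).2 x)).
    by rewrite (reindex _ (onW_bij _ (enum_val_bij _))); apply: eq_bigr => i _; rewrite mxE.
  by move=> a _; exact: (cp a).2.
pose d a := c (enum_rank a) 0.
have dS' a : d a *: (Im a).2 x \in scar (S a) x.
  by have [_ _ /(_ x) mx _] := Imp a; apply: (rpredZ (d a)) mx.
(* The given components and the zero family both sum to 0, so uniqueness in the direct sum
   identifies them. *)
have [u [_ uu]] := dS x 0.
have e1 := uu (fun a => SubObj (dS' a)).
have e2 := uu (fun=> 0).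
have du a : d a *: (Im a).2 x = 0.
  transitivity (incl (S a) x (u a)).
    rewrite e1 //= -[RHS]c0 /combo (reindex _ (onW_bij _ (enum_val_bij _))).
    by apply: eq_bigr => i _; rewrite /d enum_valK.
  by rewrite e2 ?linear0 // big1 // => b _; rewrite linear0.
apply/colP => i; rewrite mxE; apply/eqP/negP => /negP ci0.
have := du (enum_val i); rewrite /d enum_valK => /eqP.
rewrite scaler_eq0 (negPf ci0) /=; have [_ n0 _ _] := Imp (enum_val i).
exact/negP/n0/sc.
Qed.

Section Line.
Context M I (m : forall x, M x) (ms : is_section I m).

(** The span of a section; the zero section gives the zero submodule, which later supplies the zero
    summands of [M]. *)
Definition line_pred (x : P) : {pred M x} := [pred v | `[< exists c, v = c *: m x >]].

Lemma line_closed x : submod_closed (@line_pred x).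
Proof.
split=> [|a u v]; rewrite !inE; first by exists 0; rewrite scale0r.
by case=> c -> [d ->]; exists (a * c + d); rewrite scalerDl scalerA.
Qed.

Lemma line_tr x y (h : val x <= val y) (v : M x) :
  v \in @line_pred x -> ptr M h v \in @line_pred y.
Proof.
rewrite !inE => -[c ->]; rewrite linearZ /=.
have [Ix|nIx] := pselect ((I : set P) x); first by exists c; rewrite ms.2.
by exists 0; rewrite ms.1 // linear0 scaler0 scale0r.
Qed.

Definition line : submodule M := Submodule line_closed line_tr.

Lemma line_mem x c : c *: m x \in scar line x.
Proof. by rewrite inE; exists c. Qed.

Lemma lineP x (v : submod line x) : exists c, incl line x v = c *: m x.
Proof. by have := valP v; rewrite inE. Qed.

Lemma line_isomorphic :
  (forall x, (I : set P) x -> m x != 0) -> isomorphic (submod line) (intmod K I).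
Proof.
move=> m0; have m1 x : m x \in scar line x by rewrite -[m x]scale1r line_mem.
apply: (@isomorphic_section (submod line) I (fun x => SubObj (m1 x))) => [|x Ix|x v].
- split=> [x nIx|x y h Ix]; apply: val_inj; first exact: ms.1.
  exact: ms.2.
- by apply: contraNN (m0 _ Ix) => /eqP[->].
by have [c vc] := lineP v; exists c; apply: val_inj.
Qed.

End Line.

Section LineDsum.
Context M (q : nat) (J : 'I_q -> pinterval P) (t : 'I_q -> forall x, M x).
Context (ts : forall a, is_section (J a) (t a)).

(** Independence concerns the terms and not the coefficients, since [t a x] may vanish. *)
Lemma line_internal_dsum :
  (forall x v, exists c : 'I_q -> K, v = \sum_a c a *: t a x) ->
  (forall x (c : 'I_q -> K), \sum_a c a *: t a x = 0 -> forall a, c a *: t a x = 0) ->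
  internal_dsum (fun a => line (ts a)).
Proof.
move=> gen free x v; have [c vc] := gen x v.
exists (fun a => SubObj (line_mem (ts a) x (c a))); split=> [|u uv]; first by rewrite vc.
apply: functional_extensionality_dep => a; apply: val_inj => /=.
have /choice[d du] : forall b, exists d, incl (line (ts b)) x (u b) = d *: t b x.
  by move=> b; apply: lineP.
apply/eqP; rewrite -subr_eq0; apply/eqP; rewrite [val (u a)]du -scalerBl.
apply: (free x (fun b => c b - d b)).
under eq_bigr do rewrite scalerBl.
by rewrite sumrB -vc -uv; apply/eqP; rewrite subr_eq0; apply/eqP/eq_bigr => b _; rewrite du.
Qed.

Lemma proj_line (h : internal_dsum (fun a => line (ts a))) a x (c : 'I_q -> K) :
  incl _ x (proj h a x (\sum_b c b *: t b x)) = c a *: t a x.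
Proof.
rewrite /= /proj_fun.
by rewrite (@component_uniq _ _ _ _ _ _ h _ _ (fun b => SubObj (line_mem (ts b) x (c b)))).
Qed.

End LineDsum.

End Generators.

(** * The matrices of a morphism and their right-end part *)

Section MatrixOfHom.
Context (R : realType) (P : set R) (K : fieldType) (M N : persmod P K).
Context (f : pmor M N) (p q : nat).
Context (I : 'I_p -> pinterval P) (m : 'I_p -> forall x, M x).
Context (J : 'I_q -> pinterval P) (n : 'I_q -> forall x, N x).
Hypotheses (mb : interval_basis I m) (nb : interval_basis J n).

Lemma combo_restrict x (c : 'cV[K]_q) :
  combo n x (\col_j if `[< (J j : set P) x >] then c j 0 else 0) = combo n x c.
Proof.
apply: eq_bigr => j _; rewrite mxE; case: asboolP => // nJx.
by case: nb => /(_ j)[-> //] _ _ _; rewrite !scaler0.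
Qed.

Lemma supported_restrict x (c : 'cV[K]_q) :
  supported J x (\col_j if `[< (J j : set P) x >] then c j 0 else 0).
Proof. by move=> j; rewrite mxE; case: asboolP; rewrite ?eqxx. Qed.

(** The last clause asks neither [x] in [J j] nor [y] in [I i]. Together with the support clause it
    therefore forces both entries to vanish when either membership fails. *)
Lemma pointwise_matrices : exists Phi : P -> 'M[K]_(q, p),
  [/\ forall x c, f x (combo m x c) = combo n x (Phi x *m c),
      forall x j i, Phi x j i != 0 -> (J j : set P) x /\ (I i : set P) x
    & forall x y j i, val x <= val y -> (I i : set P) x -> (J j : set P) y ->
        Phi x j i = Phi y j i].
Proof.
have [msec _ _] := mb; have [nsec ngen nfree] := nb.
have ninj := interval_basis_inj nb.
have /choice[F Fp] : forall xi : P * 'I_p, exists c : 'cV[K]_q,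
    supported J xi.1 c /\ f xi.1 (m xi.2 xi.1) = combo n xi.1 c.
  by move=> [x i]; have [c ? ?] := ngen x (f x (m i x)); exists c.
exists (fun x => \matrix_(j, i) F (x, i) j 0); split=> [x c|x j i|x y j i xy Ix Jy].
- rewrite linear_sum /=.
  have -> : (\matrix_(j, i) F (x, i) j 0) *m c = \sum_i c i 0 *: F (x, i).
    apply/colP => j; rewrite mxE summxE; apply: eq_bigr => i _.
    by rewrite !mxE mulrC.
  rewrite linear_sum; apply: eq_bigr => i _; rewrite !linearZ /=.
  by rewrite (Fp (x, i)).2.
- rewrite mxE => F0; split; first exact: (Fp (x, i)).1 F0.
  apply: contrapT => nIx; move: F0; rewrite (_ : F (x, i) = 0) ?mxE ?eqxx //.
  apply: (nfree x); first exact: (Fp (x, i)).1.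
  by rewrite -(Fp (x, i)).2 /= (msec i).1 // linear0.
have : combo n y (F (x, i)) = combo n y (F (y, i)).
  rewrite -(Fp (y, i)).2 /= -((msec i).2 _ _ xy) // hmap_nat (Fp (x, i)).2 /=.
  rewrite /combo linear_sum; apply: eq_bigr => k _; rewrite linearZ /=.
  have [->|/((Fp (x, i)).1) Jx] := eqVneq (F (x, i) k 0) 0; first by rewrite !scale0r.
  by rewrite (nsec k).2.
(* The coordinates found at [x] may involve generators that have died at [y]; these are dropped
   before comparing. *)
rewrite -combo_restrict => /(ninj _ _ _ (@supported_restrict _ _) (Fp (y, i)).1) /colP/(_ j).
by rewrite !mxE; case: asboolP.
Qed.

(* Between intervals with the same right end the coefficient of a morphism does
   not depend on the point, so that part of [f] is a single matrix. *)
Lemma right_end_matrix (Phi : P -> 'M[K]_(q, p)) :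
  (forall x j i, Phi x j i != 0 -> (J j : set P) x /\ (I i : set P) x) ->
  (forall x y j i, val x <= val y -> (I i : set P) x -> (J j : set P) y ->
     Phi x j i = Phi y j i) ->
  exists2 F : 'M[K]_(q, p), compat (@sre_le R P) J I F &
    forall j i x, same_right_end (I i) (J j) -> (I i : set P) x -> Phi x j i = F j i.
Proof.
move=> Phi_supp Phi_nat; have [z Iz] := choice (fun i => iset_nonempty (I i)).
(* If [I i] has a point [y] outside [J j], it lies to the left of [J j]; the coefficient is zero at
   [y] and stays so along [I i]. *)
have noncontained j i : same_right_end (I i) (J j) -> ~ I i `<=` J j ->
    forall x, (I i : set P) x -> Phi x j i = 0.
  move=> IJ /existsNP[y /not_implyP[Iy nJy]] x Ix.
  apply: contrapT => /eqP Px; have [Jx _] := Phi_supp _ _ _ Px.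
  have yx : val y <= val x.
    by rewrite leNgt; apply/negP => /ltW xy; apply: nJy; apply: sre_mem IJ Iy Jx xy.
  move/eqP: Px; apply; rewrite -(Phi_nat y) //.
  by apply: contrapT => /eqP/Phi_supp[].
exists (\matrix_(j, i) if `[< same_right_end (I i) (J j) >] then Phi (z i) j i else 0).
  move=> j i; rewrite mxE; case: asboolP => [IJ F0|]; last by rewrite eqxx.
  split=> //; apply: contrapT => /(noncontained _ _ IJ)/(_ _ (Iz i)) e.
  by rewrite e eqxx in F0.
move=> j i x IJ Ix; rewrite mxE; case: asboolP => // _.
have [sIJ|nIJ] := pselect (I i `<=` J j); last by rewrite !(noncontained j i).
have [xz|/ltW zx] := leP (val x) (val (z i)).
  by rewrite (Phi_nat x (z i)) //; apply: sIJ.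
by rewrite (Phi_nat (z i) x) //; apply: sIJ.
Qed.

(* Near the right end of an interval [I i0], no vector of the summands with that
   right end has components in summands of [N] with another right end. *)
Lemma right_end_matrix_inj (Phi : P -> 'M[K]_(q, p)) (F : 'M[K]_(q, p)) :
  (forall x v, f x v = 0 -> v = 0) ->
  (forall x c, f x (combo m x c) = combo n x (Phi x *m c)) ->
  (forall x j i, Phi x j i != 0 -> (J j : set P) x /\ (I i : set P) x) ->
  (forall x y j i, val x <= val y -> (I i : set P) x -> (J j : set P) y ->
     Phi x j i = Phi y j i) ->
  compat (@sre_le R P) J I F ->
  (forall j i x, same_right_end (I i) (J j) -> (I i : set P) x -> Phi x j i = F j i) ->
  forall u : 'cV_p, F *m u = 0 -> u = 0.
Proof.
move=> f0 fPhi Phi_supp Phi_nat cF PhiF u Fu; apply/colP => i0.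
rewrite [RHS]mxE; apply: contrapT => /eqP u0.
pose I0 := I i0.
pose u' : 'cV[K]_p := \col_i if `[< same_right_end I0 (I i) >] then u i 0 else 0.
(* One condition per summand of [M] and of [N], each holding from some point of [I0] onwards; the
   sum type lets one upper bound handle them all. *)
pose near (a : 'I_p + 'I_q) (x : P) := match a with
  | inl i => same_right_end I0 (I i) -> (I i : set P) x
  | inr j => ~ same_right_end I0 (J j) ->
             forall i, same_right_end I0 (I i) -> (I i : set P) x -> Phi x j i = 0
  end.
have /choice[z zp] : forall a, exists z, (I0 : set P) z /\
    forall x, (I0 : set P) x -> val z <= val x -> near a x.
  have [w0 Iw0] := iset_nonempty I0.
  case=> [i|j].
    have [e|ne] := pselect (same_right_end I0 (I i)); last by exists w0; split=> // x _ _ /ne.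
    have [y Iy] := iset_nonempty (I i).
    have [z Iz yz] := same_right_end_cofinal (sre_sym e) Iy.
    exists z; split=> // x I0x zx _; apply: sre_mem e I0x Iy _; exact: le_trans yz zx.
  have [e|ne] := pselect (same_right_end I0 (J j)).
    by exists w0; split=> // x _ _ /(_ e).
  (* Either [J j] ends before [I0] and is absent past some [z], or it reaches a point [y] beyond
     [I0], where the summands ending with [I0] are already zero; both cases kill the coefficient. *)
  have [c1|/existsNP[z /not_implyP[Iz nJ]]] := pselect (cofinal I0 (J j)); last first.
    exists z; split=> // x I0x zx _ i _ _; apply: contrapT => /eqP/Phi_supp[Jx _].
    by apply: nJ; exists x.
  have [c2|/existsNP[y /not_implyP[Jy nI]]] := pselect (cofinal (J j) I0).
    by case: ne; apply/same_right_endP.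
  exists w0; split=> // x I0x _ _ i e Iix.
  have xy : val x <= val y.
    by rewrite leNgt; apply/negP => /ltW yx; apply: nI; exists x.
  rewrite (Phi_nat x y) //; apply: contrapT => /eqP/Phi_supp[_ Iy]; apply: nI.
  exact: same_right_end_cofinal (sre_sym e) _ Iy.
have [x I0x xz] := interval_upper_bound (fun a => (zp a).1).
have nx a : near a x by apply: (zp a).2.
have su : supported I x u'.
  by move=> i; rewrite mxE; case: asboolP => [e _|]; [exact: (nx (inl i))|rewrite eqxx].
(* Rows with the right end of [I0] reproduce [F *m u], because [F] vanishes between different right
   ends; the other rows are zero by the choice of [x]. *)
have Pu : Phi x *m u' = 0.
  apply/colP => j; rewrite mxE [RHS]mxE.
  have [e|ne] := pselect (same_right_end I0 (J j)).
    have /colP/(_ j) := Fu; rewrite mxE [RHS]mxE => {2}<-.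
    apply: eq_bigr => i _; rewrite mxE; case: asboolP => [ei|nei].
      rewrite (PhiF j i) //; first exact: sre_trans (sre_sym ei) e.
      exact: (nx (inl i)).
    rewrite mulr0; have [->|/cF[IJ _]] := eqVneq (F j i) 0; first by rewrite mul0r.
    by case: nei; apply: sre_trans e (sre_sym IJ).
  rewrite big1 // => i _; rewrite mxE; case: asboolP => [ei|]; last by rewrite mulr0.
  by rewrite (nx (inr j)) ?mul0r //; apply: (nx (inl i)).
have : combo m x u' = 0 by apply: f0; rewrite fPhi Pu linear0.
have [_ _ mfree] := mb; move/(mfree _ _ su)/colP/(_ i0).
rewrite !mxE; case: asboolP => [_ e|]; last by move=> h _; apply: h.
by rewrite e eqxx in u0.
Qed.

End MatrixOfHom.

(** * Aligned generators and the final decomposition *)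

Lemma aligned_bases (R : realType) (P : set R) (K : fieldType) (M N : persmod P K)
    (f : pmor M N) :
  finitely_interval_decomposable M -> finitely_interval_decomposable N -> mono f ->
  exists p q (I : 'I_p -> pinterval P) (m : 'I_p -> forall x, M x)
    (J : 'I_q -> pinterval P) (n : 'I_q -> forall x, N x)
    (Phi : P -> 'M[K]_(q, p)) (s : 'I_p -> 'I_q),
    [/\ interval_basis I m /\ interval_basis J n,
        forall x i, (I i : set P) x -> f x (m i x) = combo n x (col i (Phi x)),
        injective s, forall i, sre_le (I i) (J (s i))
      & forall x j i, (I i : set P) x -> same_right_end (I i) (J j) ->
          Phi x j i = (j == s i)%:R].
Proof.
move=> /decomposable_basis[p [I [m mb]]] /decomposable_basis[q [J [n nb]]] /mono_eq0 f0.
have [Phi [fPhi Phi_supp Phi_nat]] := pointwise_matrices f mb nb.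
have [F cF PhiF] := right_end_matrix Phi_supp Phi_nat.
have kF := right_end_matrix_inj mb f0 fPhi Phi_supp Phi_nat cF PhiF.
have [D [D' [C [C' [s [[cD cD'] [cC cC'] [DD CC] sinj DFC]]]]]] :=
  compat_elimination (@sre_le_refl R P) (@sre_le_trans R P) (@sre_le_up R P)
    (@sre_le_down R P) cF kF.
(* Target coordinates change by [D], so the target generators change by its inverse [D']. *)
exists p, q, I, (change_basis I m C), J, (change_basis J n D'),
  (fun x => D *m Phi x *m C), s; split=> //.
- split; first exact: interval_basis_change cC cC' CC mb.
  exact: interval_basis_change cD' cD DD nb.
- move=> x i Ix; rewrite {1}/change_basis; case: asboolP => // _.
  rewrite fPhi -[Phi x *m _]mul1mx -DD -mulmxA -(@combo_change_basis _ _ _ _ _ J).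
    by rewrite !colE -!mulmxA.
  apply: supported_mul cD _ => j; rewrite mxE => /sum_neq0[k].
  by rewrite mulf_eq0 negb_or => /andP[/Phi_supp[]].
- move=> i; have := DFC (s i) i; rewrite eqxx => e.
  have : compat (@sre_le R P) J I (D *m F *m C).
    have tr := @sre_le_trans R P; exact: (compat_mul tr (compat_mul tr cD cF) cC).
  by apply; rewrite e oner_neq0.
(* [C] and [D] mix only generators with equal right ends, so the entries of [Phi x] that contribute
   here are entries of [F]. *)
move=> x k i Ix IJ; rewrite -DFC mxE [RHS]mxE; apply: eq_bigr => i' _.
have [->|/cC[ii' sii']] := eqVneq (C i' i) 0; first by rewrite !mulr0.
congr (_ * _); rewrite mxE [RHS]mxE; apply: eq_bigr => j _.
have [->|/cD[jk _]] := eqVneq (D k j) 0; first by rewrite !mul0r.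
congr (_ * _); apply: PhiF; last exact: sii'.
exact: sre_trans (sre_sym ii') (sre_trans IJ (sre_sym jk)).
Qed.

(** Summing over the fibres of [s] gives one term or none for each [a]. *)
Lemma sum_matched (K : pzSemiRingType) (V : lSemiModType K) (p q : nat)
    (s : 'I_p -> 'I_q) (G : 'I_p -> V) : injective s ->
  \sum_i G i = \sum_a (if [pick i | s i == a] is Some i then G i else 0).
Proof.
move=> sinj; rewrite (partition_big s predT) //=; apply: eq_bigr => a _.
case: pickP => [i /eqP <-|sa]; last by rewrite big_pred0.
by apply: big_pred1 => k /=; rewrite (inj_eq sinj).
Qed.

Theorem theorem1p6 (R : realType) (P : set R) (K : fieldType)
  (M N : persmod P K) (f : pmor M N)
  (hM : finitely_interval_decomposable M)
  (hN : finitely_interval_decomposable N)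
  (hf : mono f) :
  exists (A : finType) (S : A -> submodule M) (T : A -> submodule N)
    (hS : internal_dsum S) (hT : internal_dsum T),
    [/\ forall a, is_interval_module (submod (S a)) \/
          zero_module (submod (S a)),
        forall a, is_interval_module (submod (T a))
      & forall a, ~ zero_module (submod (S a)) ->
        [/\ same_right_end_mod (submod (S a)) (submod (T a)),
            mono (comp_hom (proj hT a) (comp_hom f (incl (S a)))),
            forall b, b <> a ->
              same_right_end_mod (submod (T b)) (submod (S a)) ->
              hom_eq (comp_hom (proj hT b) (comp_hom f (incl (S a))))
                (zero_hom (submod (S a)) (submod (T b)))
          & forall b, b <> a ->
              same_right_end_mod (submod (S b)) (submod (T a)) ->
              hom_eq (comp_hom (proj hT a) (comp_hom f (incl (S b))))
                (zero_hom (submod (S b)) (submod (T a)))]].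
Proof.
have [p [q [I [m [J [n [Phi [s]]]]]]]] := aligned_bases hM hN hf.
move=> [[mb nb] fPhi sinj IJ PhiE].
have [msec mgen mfree] := mb; have [nsec ngen nfree] := nb.
(* Summands are indexed by the generators of [N]. An unmatched index gets the zero section, which is
   a section over any interval; [J a] is a default there. *)
pose L (a : 'I_q) := if [pick i | s i == a] is Some i then I i else J a.
pose l (a : 'I_q) : forall x, M x :=
  if [pick i | s i == a] is Some i then m i else fun=> 0.
have picks i : [pick k | s k == s i] = Some i.
  by case: pickP => [k /eqP/sinj->//|/(_ i)]; rewrite eqxx.
have Ls i : L (s i) = I i by rewrite /L picks.
have ls i x : l (s i) x = m i x by rewrite /l picks.
have lsec a : is_section (L a) (l a).
  rewrite /L /l; case: pickP => // _.
  by split=> // x y h _; rewrite linear0.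
have zero_or_matched a : (forall x, l a x = 0) \/ exists i, a = s i.
  by rewrite /l; case: pickP => [i /eqP <-|]; [right; exists i|left].
have hS : internal_dsum (fun a => line (lsec a)).
  apply: line_internal_dsum => [x v|x c c0 a].
    have [c _ ->] := mgen x v.
    exists (fun a => if [pick i | s i == a] is Some i then c i 0 else 0).
    rewrite /combo (sum_matched _ sinj); apply: eq_bigr => a _; rewrite /l.
    by case: pickP => // _; rewrite scale0r.
  have [->|[i ->]] := zero_or_matched a; first by rewrite scaler0.
  rewrite ls; have [Ix|nIx] := pselect ((I i : set P) x); last first.
    by rewrite (msec i).1 // scaler0.
  pose d : 'cV[K]_p := \col_i c (s i).
  suff /colP/(_ i) : (\col_i if `[< (I i : set P) x >] then d i 0 else 0) = 0.
    by rewrite !mxE; case: asboolP => // _ ->; rewrite scale0r.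
  apply: (mfree x); first exact: supported_restrict.
  rewrite (combo_restrict mb) -[RHS]c0 /combo (sum_matched _ sinj).
  apply: eq_bigr => b _; rewrite /l.
  by case: pickP => [k /eqP <-|_]; rewrite ?mxE ?scaler0.
have hT : internal_dsum (fun a => line (nsec a)).
  apply: line_internal_dsum => [x v|x c c0 a].
    by have [c _ ->] := ngen x v; exists (fun a => c a 0).
  have [Jx|nJx] := pselect ((J a : set P) x); last by rewrite (nsec a).1 // scaler0.
  pose d : 'cV[K]_q := \col_i c i.
  suff /colP/(_ a) : (\col_j if `[< (J j : set P) x >] then d j 0 else 0) = 0.
    by rewrite !mxE; case: asboolP => // _ ->; rewrite scale0r.
  apply: (nfree x); first exact: supported_restrict.
  by rewrite (combo_restrict nb) -[RHS]c0; apply: eq_bigr => b _; rewrite mxE.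
have isoT a : isomorphic (submod (line (nsec a))) (intmod K (J a)).
  by apply: line_isomorphic => x; apply: (interval_basis_neq0 nb).
have isoS i : isomorphic (submod (line (lsec (s i)))) (intmod K (I i)).
  by rewrite -Ls; apply: line_isomorphic => x; rewrite Ls ls; apply: (interval_basis_neq0 mb).
have zeroS a : (forall x, l a x = 0) -> zero_module (submod (line (lsec a))).
  by move=> la x v; apply: val_inj; have [c] := lineP v; rewrite la scaler0.
have coeff i b x (v : submod (line (lsec (s i))) x) : (I i : set P) x ->
    exists2 c, incl _ x v = c *: m i x &
      incl _ x (proj hT b x (f x (incl _ x v))) = (c * Phi x b i) *: n b x.
  move=> Ix; have [c vc] := lineP v; rewrite ls in vc; exists c => //.
  have -> : f x (incl _ x v) = \sum_b (c * Phi x b i) *: n b x.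
    rewrite vc linearZ /= fPhi // scaler_sumr.
    by apply: eq_bigr => a _; rewrite mxE scalerA.
  exact: (proj_line hT b x (fun a => c * Phi x a i)).
have vanish i x (v : submod (line (lsec (s i))) x) : ~ (I i : set P) x -> v = 0.
  move=> nIx; apply: val_inj; have [c] := lineP v.
  by rewrite ls (msec i).1 // scaler0.
exists 'I_q, (fun a => line (lsec a)), (fun a => line (nsec a)), hS, hT; split.
- move=> a; have [/zeroS|[i ->]] := zero_or_matched a; first by right.
  by left; exists (I i).
- by move=> a; exists (J a).
move=> a; have [/zeroS//|[i ->] _] := zero_or_matched a.
(* Serves both vanishing claims: for equal right ends and [b] different from [s k], the coefficient
   is 0. *)
have off k b : b <> s k -> same_right_end (I k) (J b) ->
    hom_eq (comp_hom (proj hT b) (comp_hom f (incl (line (lsec (s k))))))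
      (zero_hom _ _).
  move=> bk kb x v; have [Ix|nIx] := pselect ((I k : set P) x); last first.
    by rewrite (vanish _ _ v nIx) !linear0.
  apply: val_inj; have [c _ e] := coeff k b x v Ix; rewrite [LHS]e.
  by rewrite PhiE // (introF eqP bk) mulr0 scale0r.
split=> [||b bi|b bi].
- exact/(same_right_end_modP (isoS i) (isoT (s i)))/(IJ i).1.
- apply: mono_ker0 => x v e; have [Ix|nIx] := pselect ((I i : set P) x);
    last exact: vanish nIx.
  have [c vc ec] := coeff i (s i) x v Ix; apply: val_inj; rewrite [LHS]vc.
  (* The coefficient at the matched index is 1, and [n (s i) x] is nonzero because [I i] is
     contained in [J (s i)]. *)
  have : (c * Phi x (s i) i) *: n (s i) x = 0.
    by rewrite -ec (e : proj hT (s i) x (f x (incl _ x v)) = 0) linear0.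
  rewrite PhiE // ?eqxx ?mulr1; last exact: (IJ i).1.
  move/eqP; rewrite scaler_eq0 (negPf (interval_basis_neq0 nb _)) ?orbF.
    by move/eqP->; rewrite scale0r.
  exact: (IJ i).2.
- move=> /(same_right_end_modP (isoT b) (isoS i)) e.
  by apply: off => //; apply: sre_sym.
(* For an unmatched [b] the source summand is zero and the claim is immediate. *)
have [la|[k bk]] := zero_or_matched b.
  by move=> _ x v; rewrite (zeroS b la x v) !linear0.
rewrite bk => /(same_right_end_modP (isoS k) (isoT (s i))) e.
by apply: off => // ik; apply: bi; rewrite bk ik.
Qed.
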